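(* Let $n,k,\ell,\ell',t$ be integers with $n\ge 2$ and $k\ge \ell\ge \ell'\ge t\ge 1$. Let $[m]=X_1\cup\dots\cup X_k$ with the $X_i$ pairwise disjoint, $|X_i|=n$, and let $v_i$ be the smallest element of $X_i$. Define $\mathcal{F}_0=\{F\in\mathcal{H}(n,k,\ell): |F\cap\{v_1,\dots,v_{\ell'}\}|\ge t\}$ and $\mathcal{G}_0=\{\{v_1,\dots,v_{\ell'}\}\}$, and for every integer $a\ge 1$ define $\mathcal{F}_a=\{F\in\mathcal{H}(n,k,\ell): \{v_1,\dots,v_a\}\subseteq F\}$ and $\mathcal{G}_a=\{G\in\mathcal{H}(n,k,\ell'): |G\cap\{v_1,\dots,v_a\}|\ge t\}$. If $\mathcal{F}\subseteq\mathcal{H}(n,k,\ell)$ and $\mathcal{G}\subseteq\mathcal{H}(n,k,\ell')$ are both non-empty and cross $t$-intersecting, then $$|\mathcal{F}|+|\mathcal{G}|\le \max\Big\{|\mathcal{F}_0|+|\mathcal{G}_0|,\ \max_{a\in[\ell'+1,\ell]}\{|\mathcal{F}_a|+|\mathcal{G}_a|\}\Big\},$$ where the inner maximum is omitted if $\ell=\ell'$.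
   Context: For integers $p\le q$, $[p,q]=\{p,p+1,\dots,q\}$ and $[q]=[1,q]$. Here $m=kn$ and the elements of $[m]$ carry their natural order. For $\ell\in[k]$, $\mathcal{H}(n,k,\ell)=\{H\subseteq[m]: |H|=\ell,\ |H\cap X_i|\le 1 \text{ for all } i\in[k]\}$. Two families $\mathcal{F},\mathcal{G}$ are cross $t$-intersecting if $|F\cap G|\ge t$ for all $F\in\mathcal{F}$, $G\in\mathcal{G}$. *)

(* Defs.v *)
From mathcomp Require Import all_boot.
Set Implicit Arguments. Unset Strict Implicit. Unset Printing Implicit Defensive.

(* Ground set [m] is modelled by 'I_m (element j : 'I_m stands for j+1;
   the natural order is preserved).  Parts X_1..X_k are indexed by 'I_k
   (index i stands for X_(i+1)). *)

Definition Hfam (m k l : nat) (X : 'I_k -> {set 'I_m}) : {set {set 'I_m}} :=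
  [set H : {set 'I_m} | (#|H| == l) && [forall i, #|H :&: X i| <= 1]].

Definition Vset (m k a : nat) (v : 'I_k -> 'I_m) : {set 'I_m} :=
  [set v i | i : 'I_k & (i < a)%N].

Definition F0 (m k l l' t : nat) (X : 'I_k -> {set 'I_m}) (v : 'I_k -> 'I_m)
  : {set {set 'I_m}} :=
  [set F in Hfam l X | t <= #|F :&: Vset l' v|].

Definition G0 (m k l' : nat) (v : 'I_k -> 'I_m) : {set {set 'I_m}} :=
  [set Vset l' v].

Definition Fa (m k l a : nat) (X : 'I_k -> {set 'I_m}) (v : 'I_k -> 'I_m)
  : {set {set 'I_m}} :=
  [set F in Hfam l X | Vset a v \subset F].

Definition Ga (m k l' t a : nat) (X : 'I_k -> {set 'I_m}) (v : 'I_k -> 'I_m)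
  : {set {set 'I_m}} :=
  [set G in Hfam l' X | t <= #|G :&: Vset a v|].

Definition cross_t_intersecting (m t : nat) (F G : {set {set 'I_m}}) : Prop :=
  forall A B, A \in F -> B \in G -> t <= #|A :&: B|.

(* Main.v *)
Require Import Defs.
From mathcomp Require Import all_boot all_fingroup zify.
Set Implicit Arguments.
Unset Strict Implicit.
Unset Printing Implicit Defensive.

(** Take a cross t-intersecting pair (A, B) of maximal total size and, among these, one in which the smaller family, say A, is as small as possible. Let g be a permutation of the ground set respecting the partition into blocks. If A meets gA, then (A ∩ gA, B ∪ gB) and (A ∪ gA, B ∩ gB) are again admissible pairs and their sizes sum to 2(|A| + |B|), so both are maximal, and minimality of A forces gA = A.

Hence A is invariant under many transpositions inside blocks, and these would push a member of A off a member of B unless |A| = 1 or all blocks have two elements. In the latter case all members of A are obtained from one F in A by flips, and replacing A by {F} does not decrease the total size. So the maximum is attained with one family a singleton; as block permutations act transitively on partial transversals of a given size, its value is |F_0| + |G_0| or |F_l| + |G_l|. *)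

(** * Partial transversals and permutations respecting the blocks *)

Section Transversals.

Context (T I : finType) (pi : T -> I) (n : nat).
Context (fiber_card : forall i, #|[set x | pi x == i]| = n) (n_gt1 : 1 < n).

Definition ptrans l : {set {set T}} :=
  [set H : {set T} | (#|H| == l) && (#|pi @: H| == #|H|)].

Lemma ptransP l (H : {set T}) :
  reflect (#|H| = l /\ {in H &, injective pi}) (H \in ptrans l).
Proof.
by rewrite inE; apply: (iffP andP) => -[/eqP? /imset_injP?].
Qed.

Lemma fiber_neq x : exists2 y, pi y = pi x & y != x.
Proof.
have : 1 < #|[set y | pi y == pi x]| by rewrite fiber_card.
case/card_gt1P => a [b []]; rewrite !inE => /eqP pa /eqP pb ab.
by have [ax|ax] := eqVneq a x; [exists b; rewrite // -ax eq_sym | exists a].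
Qed.

(** Extends a partial transversal to a full one: take the point of [F] in a block where there is
    one, and any point elsewhere. This provides the inputs of [lift_perm]. *)
Lemma section_through (F : {set T}) : {in F &, injective pi} ->
  exists w : I -> T, (forall i, pi (w i) = i) /\ {in F, forall x, w (pi x) = x}.
Proof.
move=> injF.
have ex i : exists x, (pi x == i) && ((i \in pi @: F) ==> (x \in F)).
  have [/imsetP[x xF ->]|_] := boolP (i \in pi @: F); first by exists x; rewrite eqxx xF.
  have /card_gt0P[x] : 0 < #|[set y | pi y == i]| by rewrite fiber_card ltnW.
  by rewrite inE => px; exists x; rewrite px.
exists (fun i => xchoose (ex i)); split=> [i|x xF].
  by have /andP[/eqP] := xchooseP (ex i).
have /andP[/eqP pe] := xchooseP (ex (pi x)).
by move/implyP=> /(_ (imset_f _ xF)) eF; apply: injF.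
Qed.

(** All blocks have [n] points, so each can be listed with its chosen point first; matching equal
    positions of block [i] and block [s i] gives [g]. *)
Lemma lift_perm (s : {perm I}) (w w' : I -> T) :
    (forall i, pi (w i) = i) -> (forall i, pi (w' i) = i) ->
  exists g : {perm T},
    (forall x, pi (g x) = s (pi x)) /\ (forall i, g (w i) = w' (s i)).
Proof.
move=> pw pw'.
pose L (u : I -> T) i := u i :: rem (u i) (enum [set x | pi x == i]).
have LE u : (forall i, pi (u i) = i) -> forall i,
  perm_eq (L u i) (enum [set x | pi x == i]).
  by move=> pu i; rewrite perm_sym perm_to_rem // mem_enum inE pu.
have Lm u : (forall i, pi (u i) = i) -> forall i x, (x \in L u i) = (pi x == i).
  by move=> pu i x; rewrite (perm_mem (LE u pu i)) mem_enum inE.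
have Ls u : (forall i, pi (u i) = i) -> forall i, size (L u i) = n.
  by move=> pu i; rewrite (perm_size (LE u pu i)) -cardE.
have Lu u : (forall i, pi (u i) = i) -> forall i, uniq (L u i).
  by move=> pu i; rewrite (perm_uniq (LE u pu i)) enum_uniq.
(* The default [x] is never reached, since the index is below [n]; it has to be made uniform before
   [nth_uniq] applies. *)
pose f x := nth x (L w' (s (pi x))) (index x (L w (pi x))).
have ltx x : index x (L w (pi x)) < n by rewrite -(Ls w pw (pi x)) index_mem Lm.
have pf x : pi (f x) = s (pi x).
  by apply/eqP; rewrite -(Lm _ pw') mem_nth // Ls.
have injf : injective f.
  move=> x y fxy; have pxy : pi x = pi y by apply: (@perm_inj _ s); rewrite -!pf fxy.
  move: fxy; rewrite /f pxy => /eqP.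
  rewrite (set_nth_default x y) ?nth_uniq ?Ls ?Lu //; last by rewrite -pxy.
  by move/eqP/(congr1 (nth x (L w (pi y)))); rewrite !nth_index // Lm // pxy.
exists (perm injf); split=> [x|i]; first by rewrite permE.
by rewrite permE /f pw /L /= eqxx.
Qed.

Lemma lift_perm_ptrans (s : {perm I}) l (F F' : {set T}) :
    F \in ptrans l -> F' \in ptrans l -> s @: (pi @: F) = pi @: F' ->
  exists2 g : {perm T}, (forall x, pi (g x) = s (pi x)) & g @: F = F'.
Proof.
move=> /ptransP[cF injF] /ptransP[cF' injF'] sF.
have [w [pw wF]] := section_through injF.
have [w' [pw' wF']] := section_through injF'.
have [g [pg gw]] := lift_perm s pw pw'; exists g => //.
apply/eqP; rewrite eqEcard card_imset ?cF ?cF' ?leqnn ?andbT; last exact: perm_inj.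
apply/subsetP => _ /imsetP[x xF ->]; rewrite -(wF _ xF) gw.
have : s (pi x) \in pi @: F' by rewrite -sF !imset_f.
by case/imsetP => y yF' ->; rewrite wF'.
Qed.

(** Phrased without the induced permutation of [I], so that lifts and permutations acting inside the
    blocks are covered alike. *)
Definition block_auto (g : {perm T}) :=
  forall x y, (pi (g x) == pi (g y)) = (pi x == pi y).

Lemma lift_block_auto (s : {perm I}) (g : {perm T}) :
  (forall x, pi (g x) = s (pi x)) -> block_auto g.
Proof. by move=> pg x y; rewrite !pg inj_eq //; apply: perm_inj. Qed.

Lemma block_auto_ptrans g l (F : {set T}) :
  block_auto g -> F \in ptrans l -> g @: F \in ptrans l.
Proof.
move=> ag /ptransP[cF injF]; apply/ptransP; split.
  by rewrite card_imset //; apply: perm_inj.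
move=> _ _ /imsetP[x xF ->] /imsetP[y yF ->] /eqP; rewrite ag => /eqP pxy.
by rewrite (injF x y).
Qed.

Lemma card_imset_permI (g : {perm T}) (F G : {set T}) :
  #|g @: F :&: g @: G| = #|F :&: G|.
Proof.
have gI : injective g by apply: perm_inj.
by rewrite -imsetI ?card_imset // => x y _ _; apply: gI.
Qed.

Lemma imset_permK (g : {perm T}) (F : {set T}) : g^-1%g @: (g @: F) = F.
Proof.
rewrite -imset_comp -[RHS]imset_id; apply: eq_imset => x /=; exact: permK.
Qed.

Lemma imset_tpermN x y (F : {set T}) :
  x \notin F -> y \notin F -> tperm x y @: F = F.
Proof.
move=> xF yF; rewrite -[RHS]imset_id; apply: eq_in_imset => z zF.
by rewrite tpermD //; [apply: contraNneq xF => -> | apply: contraNneq yF => ->].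
Qed.

Lemma tperm_fiber x y : pi x = pi y -> forall z, pi (tperm x y z) = pi z.
Proof. by move=> pxy z; case: tpermP => [->|->|]. Qed.

Lemma fiber_block_auto (g : {perm T}) : (forall x, pi (g x) = pi x) -> block_auto g.
Proof. by move=> pg x y; rewrite !pg. Qed.

(** * Extremal pairs and their stability *)

Definition admissible l1 l2 t (A B : {set {set T}}) :=
  [&& A \subset ptrans l1, B \subset ptrans l2, A != set0, B != set0
    & [forall F in A, forall G in B, t <= #|F :&: G|]].

Lemma admissibleP l1 l2 t (A B : {set {set T}}) :
  reflect [/\ {subset A <= ptrans l1}, {subset B <= ptrans l2}, A != set0, B != set0
    & forall F G, F \in A -> G \in B -> t <= #|F :&: G|] (admissible l1 l2 t A B).
Proof.
apply: (iffP and5P) => -[/subsetP sA /subsetP sB A0 B0 AB]; split=> //.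
  by move=> F G FA GB; move/forall_inP: AB => /(_ F FA)/forall_inP; apply.
by apply/forall_inP => F FA; apply/forall_inP => G; apply: AB.
Qed.

Lemma admissibleC l1 l2 t (A B : {set {set T}}) :
  admissible l1 l2 t A B -> admissible l2 l1 t B A.
Proof.
case/admissibleP=> sA sB A0 B0 AB; apply/admissibleP; split=> // F G FB GA.
by rewrite setIC AB.
Qed.

(** The first family is the smaller one and is least among all pairs of maximal total. No order
    between [l1] and [l2] is assumed, so either of the two original families may take this place. *)
Definition extremal l1 l2 t (A B : {set {set T}}) :=
  [/\ admissible l1 l2 t A B,
      forall A' B', admissible l1 l2 t A' B' -> #|A'| + #|B'| <= #|A| + #|B|,
      forall A' B', admissible l1 l2 t A' B' -> #|A| + #|B| <= #|A'| + #|B'| ->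
        #|A| <= #|A'|
    & #|A| <= #|B|].

Lemma extremal_stab l1 l2 t (A B : {set {set T}}) (g : {perm T}) F0 :
    extremal l1 l2 t A B -> block_auto g -> F0 \in A -> g @: F0 \in A ->
  forall F, F \in A -> g @: F \in A.
Proof.
case=> /admissibleP[sA sB A0 B0 AB] mx mn leAB ag F0A gF0A.
pose gs (C : {set {set T}}) := [set g @: F | F : {set T} in C].
have cgs C : #|gs C| = #|C| by apply: card_imset; apply/imset_inj/perm_inj.
have gsp l (C : {set {set T}}) : {subset C <= ptrans l} -> {subset gs C <= ptrans l}.
  by move=> sC _ /imsetP[F FC ->]; apply/block_auto_ptrans/sC.
have gsAB F G : F \in gs A -> G \in gs B -> t <= #|F :&: G|.
  by move=> /imsetP[F1 F1A ->] /imsetP[G1 G1B ->]; rewrite card_imset_permI AB.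
have IA : g @: F0 \in A :&: gs A by rewrite inE gF0A imset_f.
have adI : admissible l1 l2 t (A :&: gs A) (B :|: gs B).
  apply/admissibleP; split.
  - by move=> F /setIP[/sA].
  - by move=> G /setUP[/sB|/(gsp _ _ sB)].
  - by apply/set0Pn; exists (g @: F0).
  - by apply: contraNneq B0 => /eqP; rewrite setU_eq0 => /andP[].
  by move=> F G /setIP[FA FgA] /setUP[/AB|/gsAB]; apply.
have mxI := mx _ _ adI.
have IA_gt0 : 0 < #|A :&: gs A| by apply/card_gt0P; exists (g @: F0).
have cA := cardsUI A (gs A); have cB := cardsUI B (gs B).
have adU : admissible l1 l2 t (A :|: gs A) (B :&: gs B).
  apply/admissibleP; split.
  - by move=> F /setUP[/sA|/(gsp _ _ sA)].
  - by move=> G /setIP[/sB].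
  - by apply: contraNneq A0 => /eqP; rewrite setU_eq0 => /andP[].
  (* By [mxI] and [IA_gt0], [B :|: gs B] has fewer than [#|A| + #|B|] members, hence fewer than
     [2 * #|B|], so [B] and [gs B] must meet. *)
  - rewrite -card_gt0; move: cA cB mxI IA_gt0 leAB; rewrite !cgs; clear; lia.
  by move=> F G /setUP[/AB|/gsAB] FP /setIP[GB GgB]; apply: FP.
have mxU := mx _ _ adU.
(* The two totals add up to twice the maximum and neither exceeds it, so the intersection pair is
   itself of maximal total. *)
have le : #|A| <= #|A :&: gs A|.
  by apply: mn adI _; move: cA cB mxU; rewrite !cgs; clear; lia.
have /eqP Aeq : A :&: gs A == A by rewrite eqEcard subsetIl.
have /eqP gsA : A == gs A by rewrite eqEcard cgs leqnn andbT; apply/setIidPl.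
by move=> F FA; rewrite gsA imset_f.
Qed.

Definition cross_nbrs l t (F : {set T}) : {set {set T}} :=
  [set G in ptrans l | t <= #|F :&: G|].

(** * Structure of the smaller family of an extremal pair *)

Section Extremal.
Context (l1 l2 t : nat) (A B : {set {set T}}).
Context (extAB : extremal l1 l2 t A B) (t_gt0 : 0 < t).

Let sA : {subset A <= ptrans l1}.
Proof. by case: extAB => /admissibleP[]. Qed.

Let sB : {subset B <= ptrans l2}.
Proof. by case: extAB => /admissibleP[]. Qed.

Let AB F G : F \in A -> G \in B -> t <= #|F :&: G|.
Proof. by case: extAB => /admissibleP[_ _ _ _ AB] _ _ _; apply: AB. Qed.

Let injA F : F \in A -> {in F &, injective pi}.
Proof. by case/sA/ptransP. Qed.

Let injB G : G \in B -> {in G &, injective pi}.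
Proof. by case/sB/ptransP. Qed.

Lemma extremal_nbrs F : F \in A -> B \subset cross_nbrs l2 t F.
Proof. by move=> FA; apply/subsetP => G GB; rewrite inE sB // AB. Qed.

Lemma extremal_stabV (g : {perm T}) (F0 F : {set T}) :
  block_auto g -> F0 \in A -> g @: F0 \in A -> g @: F \in A -> F \in A.
Proof.
move=> ag F0A gF0A gFA; rewrite -(imset_permK g F).
apply: (extremal_stab extAB _ gF0A) => //; last by rewrite imset_permK.
by move=> x y; rewrite -(ag (g^-1%g x)) !permKV.
Qed.

Lemma imset_tperm (i j : I) (P : {set I}) : i \in P -> j \in P -> tperm i j @: P = P.
Proof.
move=> iP jP; apply/eqP; rewrite eqEcard card_imset ?leqnn ?andbT; last exact: perm_inj.
by apply/subsetP => _ /imsetP[k kP ->]; case: tpermP.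
Qed.

Lemma swap_blocks F i j : F \in A -> i \in pi @: F -> j \in pi @: F ->
  exists2 g : {perm T}, (forall x, pi (g x) = tperm i j (pi x)) & g @: F = F.
Proof.
by move=> FA iF jF; apply: lift_perm_ptrans (sA FA) (sA FA) (imset_tperm iF jF).
Qed.

(** The property to be contradicted: no block met by a member of [A] can have it. *)
Definition free_block i := forall x y, pi x = i -> pi y = i ->
  forall F, F \in A -> tperm x y @: F \in A.

(** A member of [A] avoiding [x] and [y] is fixed by their transposition, which therefore stabilizes
    [A] by [extremal_stab]. *)
Lemma free_block_avoid i :
  (forall x y, pi x = i -> pi y = i -> x != y ->
     exists2 F, F \in A & (x \notin F) && (y \notin F)) -> free_block i.
Proof.
move=> av x y px py F FA; have [<-|xy] := eqVneq x y.
  by rewrite tperm1 (eq_imset _ (@perm1 _)) imset_id.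
have [F1 F1A /andP[xF1 yF1]] := av x y px py xy.
apply: (extremal_stab extAB _ F1A) => //; last by rewrite imset_tpermN.
by apply/fiber_block_auto/tperm_fiber; rewrite px py.
Qed.

(** A transposition inside block [j] is conjugated into block [i] by a block automorphism that
    exchanges the two blocks and fixes [F]. *)
Lemma free_block_trans F i j : F \in A -> i \in pi @: F -> j \in pi @: F ->
  free_block i -> free_block j.
Proof.
move=> FA iF jF fi x y px py F' F'A.
apply: (extremal_stab extAB _ FA) => //.
  by apply/fiber_block_auto/tperm_fiber; rewrite px py.
have [g pg gF] := swap_blocks FA iF jF.
apply: (extremal_stabV (lift_block_auto pg) FA); rewrite ?gF //.
have -> : g @: (tperm x y @: F) = tperm (g x) (g y) @: (g @: F).
  rewrite -!imset_comp; apply: eq_imset => z /=.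
  by rewrite -tpermJ permJ.
by rewrite gF; apply: fi; rewrite // pg ?px ?py tpermR.
Qed.

(* If one block met by [F] were free then all would be, and [F] could be moved inside [A] off any given member of [B]. *)
Lemma not_free_block F i : F \in A -> i \in pi @: F -> ~ free_block i.
Proof.
move=> FA iF fi.
have [G GB] : exists G, G \in B by apply/set0Pn; case: extAB => /admissibleP[].
pose P F' := (F' \in A) && (pi @: F' == pi @: F).
have PF : P F by rewrite /P FA eqxx.
case: (arg_minnP (fun F' => #|F' :&: G|) PF) => F1 /andP[F1A /eqP pF1] mn.
have /card_gt0P[x /setIP[xF xG]] := leq_trans t_gt0 (AB F1A GB).
have [y py yx] := fiber_neq x.
have yG : y \notin G.
  by apply: contraNN yx => yG; apply/eqP; apply: (injB GB).
have fx : free_block (pi x).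
  by apply: free_block_trans FA iF _ fi; rewrite -pF1 imset_f.
have F2A : tperm x y @: F1 \in A by apply: fx.
have : P (tperm x y @: F1).
  rewrite /P F2A -pF1 -imset_comp; apply/eqP/eq_imset => z /=.
  by rewrite tperm_fiber.
move/mn; apply/negP; rewrite -ltnNge.
rewrite [X in _ < X](cardsD1 x) !inE xF xG ltnS; apply/subset_leq_card/subsetP.
move=> _ /setIP[/imsetP[z zF ->]]; case: tpermP => [_|zy|/eqP zx _ zG].
- by rewrite (negPf yG).
- by move: yx; rewrite -zy (injA F1A zF xF) ?eqxx // zy.
- by rewrite !inE zx zF.
Qed.

(** A block met by [F] and missed by [F'] would be free, because [F'] avoids all of its points. *)
Lemma extremal_support F F' : F \in A -> F' \in A -> pi @: F = pi @: F'.
Proof.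
move=> FA F'A.
have card C : C \in A -> #|pi @: C| = l1.
  by move=> CA; have /ptransP[<- /card_in_imset] := sA CA.
apply/eqP; rewrite eqEcard !card // leqnn andbT.
apply/subsetP => i iF; apply/contraT => iF'; case: (not_free_block FA iF).
apply: free_block_avoid => x y px py _; exists F' => //.
by apply/andP; split; apply: contraNN iF' => /(imset_f pi); rewrite ?px ?py.
Qed.

(** In a block where [F] and [F'] differ, a third point would supply, for every pair of points, a
    member of [A] avoiding both, and the block would be free. *)
Lemma extremal_fiber2 F F' : F \in A -> F' \in A -> F != F' -> n = 2.
Proof.
move=> FA F'A FF'.
have [x xF xF'] : exists2 x, x \in F & x \notin F'.
  apply/subsetPn; apply: contraNN FF' => FF'; rewrite eqEcard FF'.
  by have /ptransP[-> _] := sA FA; have /ptransP[-> _] := sA F'A; rewrite leqnn.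
have [x' x'F' px] : exists2 x', x' \in F' & pi x' = pi x.
  have : pi x \in pi @: F' by rewrite -(extremal_support FA F'A) imset_f.
  by case/imsetP => x' x'F' ->; exists x'.
apply/eqP; rewrite eqn_leq n_gt1 andbT leqNgt; apply/negP => n_gt2.
case: (not_free_block FA (imset_f pi xF)); apply: free_block_avoid => y z py pz yz.
have uF u : pi u = pi x -> u != x -> u \notin F.
  by move=> pu; apply: contraNN => uF; apply/eqP; apply: (injA FA).
have uF' u : pi u = pi x -> u != x' -> u \notin F'.
  by move=> pu; apply: contraNN => uF'; apply/eqP; apply: (injA F'A); rewrite ?px.
have [|yzx] := boolP ((y != x) && (z != x)).
  by case/andP=> yx zx; exists F; rewrite // !uF.
have [|yzx'] := boolP ((y != x') && (z != x')).
  by case/andP=> yx zx; exists F'; rewrite // !uF'.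
have xx' : x != x' by apply: contraNneq xF' => ->.
(* Only the pair of [x] and [x'] remains. The transposition of [x] with a third point [w] fixes
   [F'], so it preserves [A], and it moves [F] off both [x] and [x']. *)
have /card_gt0P[w] : 0 < #|[set u | pi u == pi x] :\ x :\ x'|.
  move: n_gt2; rewrite -(fiber_card (pi x)) (cardsD1 x) (cardsD1 x' (_ :\ x)).
  by rewrite !inE px !eqxx (eq_sym x') xx'.
rewrite !inE => /and3P[wx' wx /eqP pw].
exists (tperm x w @: F).
  apply: (extremal_stab extAB _ F'A) => //; last by rewrite imset_tpermN // uF'.
  by apply/fiber_block_auto/tperm_fiber.
have nF u : u \in [set x; x'] -> u \notin tperm x w @: F.
  rewrite !inE => ux; apply/imsetP => -[v vF].
  case: tpermP => [_ uw|vw _|/eqP vx _ uv].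
  - by move: ux; rewrite uw (negPf wx) (negPf wx').
  - by move: vF; rewrite vw (negPf (uF _ pw wx)).
  - move: ux; rewrite uv (negPf vx) /= => /eqP vx'.
    by move: vx; rewrite (injA FA vF xF) ?eqxx // vx'.
have nxx' u : ~~ ((u == x) && (u == x')).
  by apply: contraNN xx' => /andP[/eqP <-].
rewrite !nF // !inE; move: yzx yzx' (nxx' y) (nxx' z);
by case: (y == x); case: (y == x'); case: (z == x); case: (z == x').
Qed.

(** * Blocks of two elements: members of the smaller family as flips *)

Section TwoElementBlocks.
Context (n2 : n = 2).

Lemma flip_exists : exists fl : T -> T,
  [/\ forall x, pi (fl x) = pi x, forall x, fl x != x
    & forall x y, pi y = pi x -> y != x -> y = fl x].
Proof.
have ex x : exists y, (pi y == pi x) && (y != x).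
  by have [y py yx] := fiber_neq x; exists y; rewrite py eqxx.
have flP x := andP (xchooseP (ex x)).
exists (fun x => xchoose (ex x)).
split=> [x|x|x y py yx]; [by case: (flP x) => /eqP|by case: (flP x)|].
have [/eqP pfl flx] := flP x.
set z := xchoose (ex x) in pfl flx *; apply/eqP/contraT => yz.
have : x |: (y |: [set z]) \subset [set u | pi u == pi x].
  by apply/subsetP => u; rewrite !inE => /or3P[]/eqP->; rewrite ?py ?pfl.
move/subset_leq_card; rewrite fiber_card n2 !cardsU1 cards1 !inE.
by rewrite !(eq_sym x) (negPf yx) (negPf flx) (negPf yz).
Qed.

Context (fl : T -> T) (pi_fl : forall x, pi (fl x) = pi x).
Context (fl_neq : forall x, fl x != x).
Context (fl_uniq : forall x y, pi y = pi x -> y != x -> y = fl x).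

Lemma flK : involutive fl.
Proof. by move=> x; apply/esym/fl_uniq; rewrite ?pi_fl // eq_sym. Qed.

Definition flip_on (J : {set I}) x := if pi x \in J then fl x else x.

Lemma pi_flip_on J x : pi (flip_on J x) = pi x.
Proof. by rewrite /flip_on; case: ifP. Qed.

Lemma flip_onK J : involutive (flip_on J).
Proof. by move=> x; rewrite /flip_on; case xJ: (pi x \in J); rewrite ?pi_fl xJ ?flK. Qed.

Lemma flip_onE F F' : F \in A -> F' \in A -> F' = flip_on (pi @: (F :\: F')) @: F.
Proof.
move=> FA F'A; apply/esym/eqP; rewrite eqEcard (card_imset _ (inv_inj (flip_onK _))).
have /ptransP[-> _] := sA FA; have /ptransP[-> _] := sA F'A; rewrite leqnn andbT.
apply/subsetP => _ /imsetP[x xF ->]; rewrite /flip_on.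
have [xF'|xF'] := boolP (x \in F').
  case: ifP => // /imsetP[y /setDP[yF yF'] pxy].
  by move: yF'; rewrite -(injA FA xF yF pxy) xF'.
rewrite imset_f ?inE ?xF ?xF' //.
have /imsetP[y yF' pxy] : pi x \in pi @: F'.
  by rewrite -(extremal_support FA F'A) imset_f.
by rewrite -(fl_uniq (esym pxy)) //; apply: contraNneq xF' => <-.
Qed.

(* The sets [J] with [flip_on J @: F \in A] form a subgroup of the subsets of [pi @: F] under symmetric difference, invariant under permutations of [pi @: F]. *)
Lemma flip_on_symdiff F (J J' K : {set I}) : F \in A ->
  flip_on J @: F \in A -> flip_on J' @: F \in A ->
  (forall k, (k \in K) = (k \in J) (+) (k \in J')) -> flip_on K @: F \in A.
Proof.
move=> FA JA J'A KE; pose g := perm (inv_inj (flip_onK J)).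
have gE (C : {set T}) : g @: C = flip_on J @: C.
  by apply: eq_imset => x; rewrite permE.
have -> : flip_on K @: F = g @: (flip_on J' @: F).
  rewrite gE -imset_comp; apply: eq_imset => x /=.
  rewrite [RHS]/flip_on pi_flip_on /flip_on KE.
  by case: (pi x \in J); case: (pi x \in J'); rewrite //= flK.
apply: (extremal_stab extAB _ FA); rewrite ?gE //.
by apply: fiber_block_auto => x; rewrite permE pi_flip_on.
Qed.

Lemma flip_on_swap F J i j : F \in A -> flip_on J @: F \in A ->
  i \in pi @: F -> j \in pi @: F -> flip_on (tperm i j @: J) @: F \in A.
Proof.
move=> FA JA iF jF; have [g pg gF] := swap_blocks FA iF jF.
suff -> : flip_on (tperm i j @: J) @: F = g @: (flip_on J @: F).
  by apply: (extremal_stab extAB (lift_block_auto pg) FA); rewrite ?gF.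
rewrite -{1}gF -!imset_comp; apply: eq_imset => x /=.
rewrite /flip_on pg mem_imset; last exact: perm_inj.
(* Being a block automorphism, [g] commutes with [fl]. *)
case: ifP => // _; apply/esym/fl_uniq; first by rewrite !pg pi_fl.
by rewrite (inj_eq perm_inj).
Qed.

(** For [a] in [J] and [b] outside it, [J] and its image under [tperm a b] differ exactly in [a] and
    [b], so this pair may be flipped. Two more swaps carry it to the pair [i], [j]. *)
Lemma flip_on_pair F J i j : F \in A -> flip_on J @: F \in A ->
    J \subset pi @: F -> J != set0 -> J != pi @: F ->
    i \in pi @: F -> j \in pi @: F -> i != j ->
  flip_on [set i; j] @: F \in A.
Proof.
move=> FA JA sJ J0 JF iF jF ij.
have [a aJ] := set0Pn _ J0.
have [b bF bJ] : exists2 b, b \in pi @: F & b \notin J.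
  by apply/subsetPn; apply: contraNN JF => ?; rewrite eqEsubset sJ.
have aF := subsetP sJ _ aJ; have ba : b != a by apply: contraNneq bJ => ->.
have abA : flip_on [set a; b] @: F \in A.
  apply: (flip_on_symdiff FA JA (flip_on_swap FA JA aF bF)) => k.
  rewrite -[k in k \in _ @: J](tpermK a b) mem_imset; last exact: perm_inj.
  rewrite !inE; case: tpermP => [->|->|/eqP ka /eqP kb].
  - by rewrite eqxx aJ (negPf bJ).
  - by rewrite eqxx orbT aJ (negPf bJ).
  - by rewrite (negPf ka) (negPf kb) addbb.
have := flip_on_swap FA abA aF iF; rewrite imsetU1 imset_set1 tpermL => ibA.
set c := tperm a i b in ibA.
have cF : c \in pi @: F by rewrite /c; case: tpermP.
have ci : c != i by rewrite -(tpermL a i) /c (inj_eq perm_inj).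
have := flip_on_swap FA ibA cF jF; rewrite imsetU1 imset_set1 tpermL.
by rewrite tpermD // eq_sym.
Qed.

(** A third member of [A] makes every pair of blocks of [F] flippable. By minimality such a flip
    cannot reduce the intersection with [G], which forces [G] into every block of [F] and leaves a
    single common point. *)
Lemma flip_min F G : F \in A -> G \in B ->
    (forall F', F' \in A -> #|F :&: G| <= #|F' :&: G|) ->
  A \subset [set F; fl @: F] \/ t = 1 /\ pi @: F \subset pi @: G.
Proof.
move=> FA GB mn.
have [sub|/subsetPn[F' F'A]] := boolP (A \subset [set F; fl @: F]); first by left.
rewrite !inE => /norP[F'F F'fl]; right.
have F'E := flip_onE FA F'A; set J := pi @: (F :\: F') in F'E.
have J0 : J != set0.
  apply: contraNneq F'F => J0; rewrite F'E J0.
  by apply/eqP; rewrite -[RHS]imset_id; apply: eq_imset => x; rewrite /flip_on inE.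
have JF : J != pi @: F.
  apply: contraNneq F'fl => JF; rewrite F'E JF.
  by apply/eqP/eq_in_imset => x xF; rewrite /flip_on imset_f.
have pair i j := @flip_on_pair F J i j FA.
(* Flipping the blocks of [x] and [j] loses the common point [x], so something must be gained in
   block [j]: the point of [G] there lies outside [F]. *)
have wit x j : x \in F -> x \in G -> j \in pi @: F -> pi x != j ->
    exists y, [/\ y \in G, pi y = j & y \notin F].
  move=> xF xG jF xj.
  have F2A : flip_on [set pi x; j] @: F \in A.
    by apply: pair; rewrite ?imset_f -?F'E //; apply/imsetS/subsetDl.
  have [|no] := boolP [exists y, [&& y \in G, pi y == j & y \notin F]].
    by case/existsP => y /and3P[yG /eqP pj yF]; exists y.
  suff : #|flip_on [set pi x; j] @: F :&: G| < #|F :&: G| by rewrite ltnNge mn.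
  rewrite [X in _ < X](cardsD1 x) !inE xF xG ltnS.
  apply/subset_leq_card/subsetP => _ /setIP[/imsetP[z zF ->]].
  rewrite /flip_on !inE; case: eqP => [zx|zx] /=.
    move=> zG; have := fl_neq z.
    have zx' : z = x by apply: (injA FA).
    by rewrite (injB GB zG xG) ?zx' ?eqxx // pi_fl.
  case: eqP => [zj zG|_ ->]; last by rewrite zF !andbT; apply: contra_notN zx => /eqP->.
  case/negP: no; apply/existsP; exists (fl z); rewrite zG pi_fl zj eqxx /=.
  apply: contraNN (fl_neq z) => fzF; apply/eqP/(injA FA) => //; exact: pi_fl.
have /card_gt0P[x /setIP[xF xG]] := leq_trans t_gt0 (AB FA GB).
split.
  apply/eqP; rewrite eqn_leq t_gt0 andbT; apply: leq_trans (AB FA GB) _.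
  apply/card_le1P => x1 /setIP[x1F x1G] x2.
  rewrite !inE; apply/andP/eqP => [[x2F x2G]|->] //.
  apply/eqP/contraT => x21.
  have [] := wit x1 (pi x2) x1F x1G (imset_f _ x2F).
    by apply: contraNneq x21 => px; rewrite (injA FA x1F x2F).
  by move=> y [yG pyx]; rewrite (injB GB yG x2G pyx) x2F.
apply/subsetP => j jF; have [<-|xj] := eqVneq (pi x) j; first by rewrite imset_f.
by have [y [yG <- _]] := wit x j xF xG jF xj; rewrite imset_f.
Qed.

(* Moving [G] off [F'] inside its blocks gives, for each [F' \in A :\ F], a further set that t-intersects [F]. *)
Lemma extremal_flip_bound F G : F \in A -> G \in B ->
    (forall F', F' \in A -> #|F :&: G| <= #|F' :&: G|) ->
  #|A| + #|B| <= #|cross_nbrs l2 t F|.+1.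
Proof.
move=> FA GB mn.
(* [H F'] below is [G] with its points in [F'] flipped; it is disjoint from [F'] and so, as [t] is
   positive, not in [B]. *)
pose psi (F' : {set T}) x := if x \in F' then fl x else x.
have pi_psi F' x : pi (psi F' x) = pi x by rewrite /psi; case: ifP.
pose H (F' : {set T}) := psi F' @: G.
have HT F' : H F' \in ptrans l2.
  have /ptransP[cG iG] := sB GB; apply/ptransP; split.
    by rewrite card_in_imset // => x y xG yG e; apply: iG; rewrite // -(pi_psi F') e pi_psi.
  by move=> _ _ /imsetP[x xG ->] /imsetP[y yG ->]; rewrite !pi_psi => /iG->.
have Hdisj F' x : F' \in A -> x \in F' -> x \notin H F'.
  move=> F'A xF'; apply/imsetP => -[y yG]; rewrite /psi; case: ifP => yF' e.
    by have := fl_neq y; rewrite -e (injA F'A xF' yF') ?eqxx // e pi_fl.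
  by move: yF'; rewrite -e xF'.
have HB F' : F' \in A -> H F' \notin B.
  move=> F'A; apply/negP => /(AB F'A)/(leq_trans t_gt0)/card_gt0P[x /setIP[xF']].
  exact/negP/Hdisj.
have [c1 c2] : {in A :\ F, forall F', t <= #|F :&: H F'|} /\ {in A :\ F &, injective H}.
  have [sub|[-> FG]] := flip_min FA GB mn.
    have F'E F' : F' \in A :\ F -> F' = fl @: F.
      by case/setD1P => F'F /(subsetP sub); rewrite !inE (negPf F'F) => /eqP.
    split=> [F' F'A|F' F'' /F'E-> /F'E->] //.
    (* [F] and [fl @: F] are disjoint, so no point common to [F] and [G] is moved. *)
    apply: leq_trans (AB FA GB) _; apply/subset_leq_card/subsetP => x /setIP[xF xG].
    rewrite inE xF; apply/imsetP; exists x => //; rewrite /psi ifN //.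
    rewrite (F'E _ F'A); apply/imsetP => -[u uF xu].
    by have := fl_neq u; rewrite -xu (injA FA xF uF) ?eqxx // xu pi_fl.
  (* As [G] meets every block of [F], in each of them [H F2] holds the point complementary to that
     of [F2]. Hence [H F2] determines [F2], and it meets every other member of [A]; one common point
     suffices as [t = 1]. *)
  have HF F1 F2 x : F1 \in A -> F2 \in A -> x \in F1 -> x \notin F2 -> x \in H F2.
    move=> F1A F2A xF1 xF2.
    have pxF : pi x \in pi @: F by rewrite (extremal_support FA F1A) imset_f.
    have /imsetP[y yG pxy] := subsetP FG _ pxF.
    have /imsetP[z zF2 pxz] : pi x \in pi @: F2 by rewrite -(extremal_support FA F2A).
    have zx : z != x by apply: contraNneq xF2 => <-.
    have zE := fl_uniq (esym pxz) zx.
    apply/imsetP; exists y => //; rewrite /psi.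
    have [yx|yx] := eqVneq y x; first by rewrite yx (negPf xF2).
    by rewrite (fl_uniq (esym pxy) yx) -zE zF2 zE flK.
  have sub (F1 F2 : {set T}) : F1 \in A -> F2 \in A -> H F1 = H F2 -> F1 \subset F2.
    move=> F1A F2A eH; apply/subsetP => x xF1; apply/contraT => xF2.
    by case/negP: (Hdisj F1 x F1A xF1); rewrite eH (HF F1).
  split=> [F' /setD1P[F'F F'A]|F1 F2 /setD1P[_ F1A] /setD1P[_ F2A] eH].
    have /subsetPn[x xF xF'] : ~~ (F \subset F').
      apply: contraNN F'F => FF'; rewrite eq_sym eqEcard FF'.
      by have /ptransP[-> _] := sA FA; have /ptransP[-> _] := sA F'A; rewrite leqnn.
    by apply/card_gt0P; exists x; rewrite inE xF (HF F).
  by apply/eqP; rewrite eqEsubset !sub.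
have dBH : [disjoint B & H @: (A :\ F)].
  rewrite disjoint_sym; apply/pred0P => G' /=; apply/negP => /andP[/imsetP[F' F'A ->]].
  by apply/negP/HB; case/setD1P: F'A.
rewrite (cardsD1 F) FA add1n addSn ltnS addnC -(card_in_imset c2).
have /eqP <- : #|B :|: H @: (A :\ F)| == #|B| + #|H @: (A :\ F)|.
  by rewrite leq_card_setU.
apply/subset_leq_card/subsetP => G' /setUP[|/imsetP[F' F'A ->]].
  exact/subsetP/extremal_nbrs.
by rewrite inE HT c1.
Qed.
End TwoElementBlocks.

(** * Reduction to a one-element family *)

Lemma extremal_bound :
  exists2 F, F \in ptrans l1 & #|A| + #|B| <= #|cross_nbrs l2 t F|.+1.
Proof.
have [F FA] : exists F, F \in A by apply/set0Pn; case: extAB => /admissibleP[].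
have [G GB] : exists G, G \in B by apply/set0Pn; case: extAB => /admissibleP[].
have [sAF|/subsetPn[F' F'A]] := boolP (A \subset [set F]).
  exists F; first exact: sA.
  (* The successor counts the one-element family, which here is [A] itself. *)
  rewrite -add1n leq_add ?(subset_leq_card (extremal_nbrs FA)) //.
  by rewrite -(cards1 F) subset_leq_card.
rewrite inE eq_sym => FF'.
have [fl [pi_fl fl_neq fl_uniq]] := flip_exists (extremal_fiber2 FA F'A FF').
case: (arg_minnP (fun F => #|F :&: G|) FA) => F1 F1A mn.
exists F1; first exact: sA.
exact: (extremal_flip_bound pi_fl fl_neq fl_uniq F1A GB).
Qed.
End Extremal.

Lemma admissible_bound (l1 l2 t : nat) (A B : {set {set T}}) :
    0 < t -> admissible l1 l2 t A B ->
  (exists2 F, F \in ptrans l1 & #|A| + #|B| <= #|cross_nbrs l2 t F|.+1) \/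
  (exists2 G, G \in ptrans l2 & #|A| + #|B| <= #|cross_nbrs l1 t G|.+1).
Proof.
move=> t0 adAB; pose tot (p : {set {set T}} * {set {set T}}) := #|p.1| + #|p.2|.
pose adm (p : {set {set T}} * {set {set T}}) := admissible l1 l2 t p.1 p.2.
have adP : adm (A, B) by [].
case: (arg_maxnP tot adP) => p0 ad0 mx0.
pose best p := adm p && (tot p0 <= tot p).
have best0 : best p0 by rewrite /best ad0 leqnn.
(* Which family is smaller is not known in advance; minimizing the minimum of both sizes gives an
   extremal pair in either order. *)
case: (arg_minnP (fun p : {set {set T}} * {set {set T}} => minn #|p.1| #|p.2|) best0) => -[C D] /andP[/= adCD le0] mn.
have mx C' D' : admissible l1 l2 t C' D' -> #|C'| + #|D'| <= #|C| + #|D|.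
  by move=> ad; apply: leq_trans (mx0 (C', D') ad) le0.
have leAB := mx _ _ adAB.
have mnCD C' D' : admissible l1 l2 t C' D' -> #|C| + #|D| <= #|C'| + #|D'| ->
    minn #|C| #|D| <= minn #|C'| #|D'|.
  by move=> ad le; apply: (mn (C', D')); rewrite /best /adm ad (leq_trans le0).
have [CD|/ltnW DC] := leqP #|C| #|D|; [left|right].
  have ext : extremal l1 l2 t C D.
    split=> // C' D' ad le; have := mnCD _ _ ad le.
    by rewrite (minn_idPl CD) leq_min => /andP[].
  by have [F FT le] := extremal_bound ext t0; exists F => //; apply: leq_trans le.
have ext : extremal l2 l1 t D C.
  split=> [|D' C' /admissibleC ad|D' C' /admissibleC ad|//]; first exact: admissibleC.
    by rewrite addnC (addnC #|D|) mx.
  rewrite addnC (addnC #|D'|) => le; have := mnCD _ _ ad le.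
  by rewrite (minn_idPr DC) leq_min => /andP[].
have [G GT le] := extremal_bound ext t0; exists G => //.
by rewrite addnC in le; apply: leq_trans le.
Qed.

(** * Transitivity on partial transversals of a given size *)

Lemma perm_imset_eq (P Q : {set I}) : #|P| = #|Q| -> exists s : {perm I}, s @: P = Q.
Proof.
move=> cPQ; pose L (R : {set I}) := enum R ++ enum (~: R).
have Lm R i : i \in L R by rewrite mem_cat !mem_enum inE orbN.
have Ls R : size (L R) = #|I| by rewrite size_cat -!cardE cardsC.
have Lu R : uniq (L R).
  rewrite cat_uniq !enum_uniq andbT /=; apply/hasPn => i.
  by rewrite !mem_enum inE.
(* Equal positions are matched; as [P] and [Q] have the same size, the initial segment [enum P] goes
   to [enum Q]. *)
pose f i := nth i (L Q) (index i (L P)).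
have lti i : index i (L P) < #|I| by rewrite -(Ls P) index_mem Lm.
have injf : injective f.
  move=> i j; rewrite /f => /eqP.
  rewrite (set_nth_default i j) ?Ls // nth_uniq ?Ls //.
  by move/eqP/(congr1 (nth i (L P))); rewrite !nth_index.
exists (perm injf); apply/eqP; rewrite eqEcard card_imset; last exact: perm_inj.
rewrite cPQ leqnn andbT; apply/subsetP => _ /imsetP[i iP ->].
have ltP : index i (enum P) < size (enum Q).
  by rewrite -cardE -cPQ cardE index_mem mem_enum.
by rewrite permE /f !nth_cat !index_cat mem_enum iP ltP -mem_enum mem_nth.
Qed.

Lemma card_cross_nbrs_le l1 l2 t (F F' : {set T}) :
  F \in ptrans l1 -> F' \in ptrans l1 -> #|cross_nbrs l2 t F| <= #|cross_nbrs l2 t F'|.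
Proof.
move=> FT F'T.
have [|s sF] := @perm_imset_eq (pi @: F) (pi @: F').
  by have /ptransP[c i] := FT; have /ptransP[c' i'] := F'T; rewrite !card_in_imset ?c ?c'.
have [g pg gF] := lift_perm_ptrans FT F'T sF.
rewrite -(card_imset _ (imset_inj (@perm_inj _ g))); apply/subset_leq_card/subsetP.
move=> _ /imsetP[G /[!inE] /andP[GT tG] ->].
have := block_auto_ptrans (lift_block_auto pg) (_ : G \in ptrans l2).
by rewrite !inE -gF card_imset_permI tG andbT; apply.
Qed.
End Transversals.

(** * Translation to the given partition and conclusion *)

Lemma block_index k m (X : 'I_k -> {set 'I_m}) :
    (forall i j, i != j -> [disjoint X i & X j]) ->
    \bigcup_(i < k) X i = [set: 'I_m] ->
  exists pi : 'I_m -> 'I_k, forall i x, (x \in X i) = (pi x == i).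
Proof.
move=> disj cover.
have ex x : exists i, x \in X i.
  by have /bigcupP[i _ xi] : x \in \bigcup_(i < k) X i; [rewrite cover inE | exists i].
exists (fun x => xchoose (ex x)) => i x; apply/idP/eqP => [xi|<-].
  apply/eqP/contraT => /disj; set j := xchoose _.
  by move/disjointFr/(_ (xchooseP (ex x))); rewrite xi.
exact: (xchooseP (ex x)).
Qed.

Lemma Hfam_ptrans k m (X : 'I_k -> {set 'I_m}) (pi : 'I_m -> 'I_k) l :
  (forall i x, (x \in X i) = (pi x == i)) -> Hfam l X = ptrans pi l.
Proof.
move=> XE; apply/setP => H; rewrite inE; apply/andP/ptransP => -[].
  move=> /eqP-> /forallP le1; split=> // x y xH yH pxy.
  have /card_le1_eqP := le1 (pi y).
  by apply; rewrite inE XE ?pxy ?xH ?yH /=.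
move=> -> inj; split=> //; apply/forallP => i; apply/card_le1_eqP => x y.
by rewrite !inE !XE => /andP[xH /eqP px] /andP[yH /eqP py]; apply: inj; rewrite ?px.
Qed.

Lemma card_Vset m k a (v : 'I_k -> 'I_m) : injective v -> a <= k -> #|Vset a v| = a.
Proof.
move=> injv ak; rewrite card_imset // -[RHS](card_ord a) -sum1_card -[RHS]sum1_card.
by rewrite (big_ord_widen k (fun _ => 1) ak); apply: eq_bigl => i; rewrite inE.
Qed.

Theorem theorem1p6 (n k l l' t m : nat) (hm : m = k * n)
  (X : 'I_k -> {set 'I_m})
  (hXsize : forall i, #|X i| = n)
  (hXdisj : forall i j, i != j -> [disjoint X i & X j])
  (hXcover : \bigcup_(i < k) X i = [set: 'I_m])
  (v : 'I_k -> 'I_m)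
  (hv_in : forall i, v i \in X i)
  (hv_min : forall i (x : 'I_m), x \in X i -> (v i <= x)%N)
  (hn : 2 <= n) (hkl : l <= k) (hll' : l' <= l) (hl't : t <= l') (ht : 1 <= t)
  (F G : {set {set 'I_m}})
  (hF : F \subset Hfam l X) (hG : G \subset Hfam l' X)
  (hF0 : F != set0) (hG0 : G != set0)
  (hcross : cross_t_intersecting t F G) :
  #|F| + #|G| <=
    maxn (#|F0 l l' t X v| + #|G0 l' v|)
         (\max_(l'.+1 <= a < l.+1) (#|Fa l a X v| + #|Ga l' t a X v|)).
Proof.
have [pi XE] := block_index hXdisj hXcover.
have fiber i : #|[set x | pi x == i]| = n.
  by rewrite -(hXsize i); apply: eq_card => x; rewrite inE XE.
have piv i : pi (v i) = i by apply/eqP; rewrite -XE.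
have VT a : a <= k -> Vset a v \in ptrans pi a.
  move=> ak; apply/ptransP; split; first exact/card_Vset/ak/(can_inj piv).
  by move=> _ _ /imsetP[i _ ->] /imsetP[j _ ->]; rewrite !piv => ->.
have HE a := Hfam_ptrans a XE.
have nbrsE a b : cross_nbrs pi b t (Vset a v) = [set H in Hfam b X | t <= #|H :&: Vset a v|].
  by apply/setP => H; rewrite [LHS]inE [RHS]inE setIC HE.
have F0E : #|F0 l l' t X v| + #|G0 l' v| = #|cross_nbrs pi l t (Vset l' v)|.+1.
  by rewrite cards1 addn1 nbrsE.
have ad : admissible pi l l' t F G.
  by apply/admissibleP; split=> //; apply/subsetP; rewrite -HE.
have [[C CT le]|[C CT le]] := admissible_bound fiber hn ht ad; apply: leq_trans le _.
  have le := card_cross_nbrs_le fiber hn l' t CT (VT _ hkl).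
  apply: leq_trans (_ : #|cross_nbrs pi l' t (Vset l v)|.+1 <= _); first by rewrite ltnS.
  (* If [l = l'], the range of [a] is empty and the bound is the first term; otherwise it is reached
     at [a = l]. *)
  have [ll'|l'l] := leqP l l'.
    by rewrite leq_max F0E (@anti_leq l l') ?leqnn // ll'.
  apply: leq_trans (leq_maxr _ _).
  apply: leq_trans (leq_bigmax_seq _ (_ : l \in index_iota l'.+1 l.+1) _) => //.
    (* The successor is absorbed by [Fa l l X v], which contains [Vset l v]. *)
    by rewrite nbrsE -add1n leq_add2r card_gt0; apply/set0Pn; exists (Vset l v);
       rewrite inE HE VT //=.
  by rewrite mem_index_iota l'l ltnS leqnn.
rewrite leq_max F0E ltnS.
by rewrite (card_cross_nbrs_le fiber hn l t CT (VT _ (leq_trans hll' hkl))).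
Qed.
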